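(* Let $k,n$ be positive integers, let $0<q<1$ or $1<q<\infty$, and let $(X_1,X_2,\ldots,X_k)$ have the $k$-variate $q$-Pólya distribution with parameters $n$, $(\alpha_1,\alpha_2,\ldots,\alpha_k)$, $\alpha$ and $q$; that is, $X_\nu$ is the number of balls of color $c_\nu$ drawn in the first $n$ $q$-drawings of the multiple $q$-Pólya urn model with initial numbers of balls $r_1,\ldots,r_{k+1}$, $r=r_1+\cdots+r_{k+1}$, and replacement parameter $m$, where $\alpha_\nu=-r_\nu/m$ and $\alpha=-r/m$. Then \begin{align*} P(X_1=x_1,X_2=x_2,\ldots,X_k=x_k)&=q^{-m\sum_{j=1}^{k}(n-y_j)(\alpha_j-x_j)}\prod_{j=1}^{k+1}\begin{bmatrix}\alpha_j\\ x_j\end{bmatrix}_{q^{-m}}\bigg/\begin{bmatrix}\alpha\\ n\end{bmatrix}_{q^{-m}}\\ &=\begin{bmatrix}n\\ x_1,x_2,\ldots,x_k\end{bmatrix}_{q^{-m}}q^{-m\sum_{j=1}^{k}(n-y_j)(\alpha_j-x_j)}\frac{\prod_{j=1}^{k+1}[\alpha_j]_{x_j,q^{-m}}}{[\alpha]_{n,q^{-m}}}, \end{align*} for all $x_j\in\{0,1,\ldots,n\}$, $j=1,\ldots,k$, with $\sum_{j=1}^k x_j\le n$, where $x_{k+1}=n-\sum_{j=1}^k x_j$, $\alpha_{k+1}=\alpha-\sum_{j=1}^k\alpha_j$, and $y_j=\sum_{i=1}^j x_i$ for $j=1,\ldots,k$.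
   Context: Notation. For real $x$ and a base $p>0$, $p\neq1$ (here $p=q^{-m}$): $[x]_p=(1-p^x)/(1-p)$; $[x]_{s,p}=[x]_p[x-1]_p\cdots[x-s+1]_p$ for $s\ge1$, $[x]_{0,p}=1$; $[s]_p!=[1]_p\cdots[s]_p$, $[0]_p!=1$; $\begin{bmatrix}x\\ s\end{bmatrix}_p=[x]_{s,p}/[s]_p!$; and $\begin{bmatrix}x\\ x_1,\ldots,x_k\end{bmatrix}_p=[x]_{x_1+\cdots+x_k,p}/([x_1]_p!\cdots[x_k]_p!)$. Multiple $q$-Pólya urn model. An urn initially contains $r$ balls of $k+1$ ordered colors $c_1,\ldots,c_{k+1}$, with $r_\nu\geq 1$ balls of color $c_\nu$; $r=r_1+\cdots+r_{k+1}$; $s_0=0$, $s_\nu=\sum_{i=1}^\nu r_i$. Let $m$ be a nonzero integer. Balls are drawn one after the other; after each drawing the drawn ball is put back together with $m$ balls of the same color (if $m<0$, this means that $-m$ balls of that color are removed). The conditional probability that the $i$th drawn ball has color $c_\nu$, given the colors of the previous $i-1$ drawn balls, with $j_\nu-1$ of them of color $c_\nu$ and a total of $i_{\nu-1}$ of them of colors $c_1,\ldots,c_{\nu-1}$ ($i_0=0$), is $$\frac{q^{s_{\nu-1}+m i_{\nu-1}}\bigl(1-q^{r_\nu+m(j_\nu-1)}\bigr)}{1-q^{r+m(i-1)}},\qquad \nu=1,\ldots,k+1.$$ It is assumed that this model is well defined for the first $n$ drawings, i.e. $r+m(i-1)>0$ for $i=1,\ldots,n$ and the displayed quantities are nonnegative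 for all configurations reachable with positive probability during the first $n$ drawings (this is automatic when $m>0$). *)

(* Defs.v *)
From HB Require Import structures.
From mathcomp Require Import all_boot all_order all_algebra.
From mathcomp Require Import all_classical all_reals all_analysis.
Set Implicit Arguments.
Unset Strict Implicit.
Unset Printing Implicit Defensive.
Import Order.TTheory GRing.Theory Num.Theory.
Local Open Scope ring_scope.
Local Open Scope classical_set_scope.

Section QNumbers.
Context {R : realType}.
Implicit Types (p x : R) (s : nat).

Definition qnum p x : R := (1 - p `^ x) / (1 - p).

Definition qfalling p x s : R := \prod_(i < s) qnum p (x - i%:R).

Definition qfact p s : R := \prod_(i < s) qnum p i.+1%:R.

Definition qbinom p x s : R := qfalling p x s / qfact p s.

Definition qmultinom p x k (xs : 'I_k -> nat) : R :=
  qfalling p x (\sum_(j < k) xs j)%N / \prod_(j < k) qfact p (xs j).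

End QNumbers.

(* The family (f_1, ..., f_k, a), indexed by 'I_k.+1. *)
Definition extend_last (T : Type) k (f : 'I_k -> T) (a : T) : 'I_k.+1 -> T :=
  fun j => if unlift ord_max j is Some i then f i else a.

(* Colors are numbered from 0: the ordinal nu : 'I_k.+1 is the color usually
   written c_(nu + 1).  A history h lists the colors of the balls already
   drawn, in order, so the next drawing has the 0-based index size h. *)
Section Urn.
Context {R : realType} {k : nat}.
Variables (q : R) (m : int) (r : 'I_k.+1 -> nat).
Implicit Types (h : seq 'I_k.+1) (nu : 'I_k.+1).

Definition balls : nat := (\sum_(nu < k.+1) r nu)%N.

Definition balls_below nu : nat := (\sum_(i < k.+1 | (i < nu)%N) r i)%N.

Definition drawn h nu : nat := count_mem nu h.

Definition drawn_below h nu : nat := count (fun c : 'I_k.+1 => (c < nu)%N) h.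

Definition draw_prob h nu : R :=
  q ^ ((balls_below nu)%:Z + m * (drawn_below h nu)%:Z)
  * (1 - q ^ ((r nu)%:Z + m * (drawn h nu)%:Z))
  / (1 - q ^ (balls%:Z + m * (size h)%:Z)).

Inductive reachable : seq 'I_k.+1 -> Prop :=
| reachable_nil : reachable [::]
| reachable_rcons h nu :
    reachable h -> 0 < draw_prob h nu -> reachable (rcons h nu).

Definition urn_well_defined (n : nat) : Prop :=
  (forall i : nat, (i < n)%N -> 0 < balls%:Z + m * i%:Z) /\
  (forall h nu, reachable h -> (size h < n)%N -> 0 <= draw_prob h nu).

End Urn.

Section Drawings.
Context d (T : measurableType d) (R : realType) (P : probability T R).

Definition cond_prob (A B : set T) : R := fine (P (A `&` B)) / fine (P B).

Variables (k : nat) (D : nat -> T -> 'I_k.+1).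

Definition history (i : nat) (w : T) : seq 'I_k.+1 := mkseq (D ^~ w) i.

(* D i is the color of the ball drawn at the (i + 1)-th drawing; D is
   unconstrained from index n on. *)
Definition qPolya_drawings (q : R) (m : int) (r : 'I_k.+1 -> nat) (n : nat) :
    Prop :=
  (forall i nu, (i < n)%N -> measurable [set w | D i w = nu]) /\
  (forall (h : seq 'I_k.+1) nu, (size h < n)%N ->
     (0 < P [set w | history (size h) w = h])%E ->
     cond_prob [set w | D (size h) w = nu] [set w | history (size h) w = h]
     = draw_prob q m r h nu).

Definition color_count (n : nat) (nu : 'I_k.+1) (w : T) : nat :=
  count_mem nu (history n w).

End Drawings.

(* X is the vector of the numbers of balls of the first k of the k + 1 colors
   among the first n drawings; lift ord_max embeds 'I_k as the first k
   elements of 'I_k.+1. *)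
Definition qPolya_distributed d (T : measurableType d) (R : realType)
    (P : probability T R) k (X : 'I_k -> T -> nat)
    (q : R) (m : int) (r : 'I_k.+1 -> nat) (n : nat) : Prop :=
  exists D : nat -> T -> 'I_k.+1,
    qPolya_drawings P D q m r n /\
    (forall (j : 'I_k) (w : T), X j w = color_count D n (lift ord_max j) w).

(* Main.v *)
Require Import Defs.
From HB Require Import structures.
From mathcomp Require Import all_boot all_order all_algebra.
From mathcomp Require Import all_classical all_reals all_analysis.
From mathcomp Require Import ring.
Set Implicit Arguments.
Unset Strict Implicit.
Unset Printing Implicit Defensive.
Import Order.TTheory GRing.Theory Num.Theory.
Local Open Scope ring_scope.
Local Open Scope classical_set_scope.

(* The probability of a color sequence [h] depends only on its content (the
   number of balls of each color), up to a factor [p ^+ inversions h], where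
   [p = q ^ (- m)] and [inversions h] counts the pairs of drawings in which the
   earlier color is the greater one.  By MacMahon's theorem the sum of
   [p ^+ inversions h] over all sequences of a given content is the
   [p]-multinomial coefficient.  The remaining factors are the [p]-falling
   factorials of the [alpha_j] since [p `^ (alpha_j - i) = q ^ (r_j + m * i)]. *)

(** * Color sequences, their contents and their inversions *)

Section Words.
Context {k : nat}.
Implicit Types (h : seq 'I_k.+1) (c nu : 'I_k.+1) (a : 'I_k.+1 -> nat).

(** Words grow at the right end, as histories do, so that an induction on [n] splits off the last
    drawing. *)
Fixpoint words (n : nat) : seq (seq 'I_k.+1) :=
  if n is n'.+1 then [seq rcons h c | h <- words n', c <- index_enum 'I_k.+1]
  else [:: [::]].

Definition has_content h a : bool := [forall nu, drawn h nu == a nu].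

Definition balls_above a nu : nat := (\sum_(i < k.+1 | (nu < i)%N) a i)%N.

Definition drawn_above h nu : nat := count (fun c : 'I_k.+1 => (nu < c)%N) h.

(** Acts on the reversed word, whose head [c] is the latest color: [c] closes one inversion with
    each earlier greater color. *)
Fixpoint inversions_rev h : nat :=
  if h is c :: h' then (drawn_above h' c + inversions_rev h')%N else 0%N.

Definition inversions h : nat := inversions_rev (rev h).

Lemma inversions_rcons h c :
  inversions (rcons h c) = (drawn_above h c + inversions h)%N.
Proof. by rewrite /inversions rev_rcons /= /drawn_above count_rev. Qed.

Lemma size_words n h : h \in words n -> size h = n.
Proof.
elim: n h => [|n IHn] h; first by rewrite inE => /eqP ->.
by case/allpairsP => -[h' c] /= [/IHn <- _ ->]; rewrite size_rcons.
Qed.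

Lemma drawn_rcons h c nu : drawn (rcons h c) nu = (drawn h nu + (c == nu))%N.
Proof. by rewrite /drawn -cats1 count_cat /= addn0. Qed.

(** Taken for the colors below [nu], above [nu], or all of them, this makes [drawn_below],
    [drawn_above] and [size] functions of the content alone. *)
Lemma count_sum_drawn (Q : pred 'I_k.+1) h :
  count Q h = (\sum_(i < k.+1 | Q i) drawn h i)%N.
Proof.
elim/last_ind: h => [|h c IHh]; first by rewrite big1.
rewrite -cats1 count_cat /= addn0 IHh cats1.
rewrite (eq_bigr (fun i => drawn h i + (c == i))%N); last first.
  by move=> i _; rewrite drawn_rcons.
rewrite big_split /=; congr (_ + _)%N.
rewrite big_mkcond (bigD1 c) //= eqxx big1 ?addn0; first by case: (Q c).
by move=> i /negPf; rewrite eq_sym => ->; case: ifP.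
Qed.

Lemma drawn_below_balls h : drawn_below h = balls_below (drawn h).
Proof. by apply: funext => nu; exact: count_sum_drawn. Qed.

Lemma drawn_above_balls h : drawn_above h = balls_above (drawn h).
Proof. by apply: funext => nu; exact: count_sum_drawn. Qed.

Lemma size_drawn h : size h = balls (drawn h).
Proof. by rewrite -(count_predT h) count_sum_drawn. Qed.

Lemma has_contentP h a : reflect (drawn h = a) (has_content h a).
Proof.
apply: (iffP forallP) => [H|-> //]; apply: funext => nu; exact/eqP/H.
Qed.

(** The subtraction is truncated: if [a c = 0] then [decr a c] is [a], hence the guard in
    [has_content_rcons]. *)
Definition decr a c : 'I_k.+1 -> nat := fun nu => (a nu - (c == nu))%N.

Lemma has_content_rcons h c a :
  has_content (rcons h c) a = (0 < a c)%N && has_content h (decr a c).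
Proof.
apply/has_contentP/andP => [<-|[ac /has_contentP hE]].
  split; first by rewrite drawn_rcons eqxx addn1.
  by apply/has_contentP/funext => nu; rewrite /decr drawn_rcons addnK.
apply: funext => nu; rewrite drawn_rcons hE /decr subnK //.
by case: eqP => // <-.
Qed.

Lemma balls_decr a c : (0 < a c)%N -> (balls (decr a c)).+1 = balls a.
Proof.
move=> ac; rewrite /balls (bigD1 c) //= [in RHS](bigD1 c) //= /decr eqxx.
rewrite -addSn subn1 prednK //; congr (_ + _)%N; apply: eq_bigr => i.
by rewrite eq_sym => /negPf ->; rewrite subn0.
Qed.

Lemma balls_above_decr a c : balls_above (decr a c) c = balls_above a c.
Proof.
apply: eq_bigr => i ci; rewrite /decr (_ : (c == i) = false) ?subn0 //.
by apply: contraTF ci => /eqP ->; rewrite ltnn.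
Qed.

End Words.

(** * p-factorials and the generating function of inversions *)

Section MacMahon.
Context {R : realType}.

Lemma qnum_nat (p : R) n : 0 < p -> qnum p n%:R = (1 - p ^+ n) / (1 - p).
Proof. by move=> p0; rewrite /qnum powR_mulrn // ltW. Qed.

Lemma qfactS (p : R) n : qfact p n.+1 = qfact p n * qnum p n.+1%:R.
Proof. by rewrite /qfact big_ord_recr. Qed.

Lemma qfact_neq0 (p : R) n : 0 < p -> p != 1 -> qfact p n != 0.
Proof.
move=> p0 p1; apply/prodf_neq0 => i _; rewrite qnum_nat // mulf_neq0 //.
  by rewrite subr_eq0 eq_sym pexpr_eq1 // ltW.
by rewrite invr_eq0 subr_eq0 eq_sym.
Qed.

Lemma prod_qfact_decr (p : R) k (a : 'I_k.+1 -> nat) c : (0 < a c)%N ->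
  \prod_nu qfact p (a nu) =
  qnum p (a c)%:R * \prod_nu qfact p (decr a c nu).
Proof.
move=> ac; rewrite (bigD1 c) //= [in RHS](bigD1 c) //= mulrA; congr (_ * _).
  by rewrite /decr eqxx subn1 mulrC -{1 2}(prednK ac) qfactS prednK.
apply: eq_bigr => i; rewrite /decr eq_sym => /negPf ->.
by rewrite subn0.
Qed.

(* Telescopes, as [p ^+ balls_above a nu * (1 - p ^+ a nu)] is
   [p ^+ balls_above a nu - p ^+ (a nu + balls_above a nu)]. *)
Lemma sum_qnum_above (p : R) k (a : 'I_k.+1 -> nat) : 0 < p ->
  \sum_nu p ^+ balls_above a nu * qnum p (a nu)%:R = qnum p (balls a)%:R.
Proof.
move=> p0; rewrite qnum_nat //.
under eq_bigr do rewrite qnum_nat // mulrA.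
rewrite -mulr_suml; congr (_ / _).
elim: k a => [|k IHk] a.
  rewrite /balls !big_ord1 /balls_above big1 ?expr0 ?mul1r // => i.
  by rewrite !ord1 ltnn.
(* Split off the lowest color: all other balls lie above it, and its removal does not change the
   counts above the other colors. *)
rewrite big_ord_recl.
have -> : balls_above a ord0 = balls (fun i => a (lift ord0 i)).
  rewrite /balls_above /balls big_mkcond [LHS]big_ord_recl ltnn /= add0n.
  by apply: eq_bigr.
have -> : balls a = (a ord0 + balls (fun i => a (lift ord0 i)))%N.
  by rewrite /balls big_ord_recl.
rewrite (eq_bigr (fun i => p ^+ balls_above (fun i => a (lift ord0 i)) i *
                           (1 - p ^+ a (lift ord0 i)))); last first.
  move=> i _; congr (p ^+ _ * _).
  rewrite /balls_above big_mkcond [LHS]big_ord_recl ltn0 /= add0n.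
  by rewrite [RHS]big_mkcond.
rewrite IHk exprD; ring.
Qed.

(* MacMahon's theorem on inversions of multiset permutations, cleared of
   denominators. *)
Lemma sum_inversions_words (p : R) k n (a : 'I_k.+1 -> nat) :
  0 < p -> balls a = n ->
  (\sum_(h <- words n | has_content h a) p ^+ inversions h)
    * \prod_nu qfact p (a nu) = qfact p n.
Proof.
move=> p0; elim: n a => [|n IHn] a an.
  have a0 nu : a nu = 0%N.
    by move/eqP: an; rewrite sum_nat_eq0 => /forallP/(_ nu)/eqP.
  rewrite /= big_mkcond big_seq1 (_ : has_content _ _ = true); last first.
    by apply/has_contentP/funext => nu; rewrite a0.
  rewrite expr0 mul1r big1; first by rewrite /qfact big_ord0.
  by move=> nu _; rewrite a0 /qfact big_ord0.
(* Group the words by their last letter [c] and expand [qnum p n.+1%:R] over [c] by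
   [sum_qnum_above]; the two sides then agree term by term. *)
rewrite /= big_mkcond big_allpairs_dep exchange_big /= mulr_suml.
rewrite qfactS -an -sum_qnum_above // mulr_sumr; apply: eq_bigr => c _.
under eq_bigr do rewrite has_content_rcons.
(* A color absent from [a] ends no word of this content, and its p-number is 0. *)
have [ac0|ac] := posnP (a c).
  by rewrite ac0 big1 ?mul0r // qnum_nat // expr0 subrr mul0r !mulr0.
rewrite (prod_qfact_decr p ac) -big_mkcond /=.
rewrite (eq_bigr (fun h => p ^+ balls_above a c * p ^+ inversions h));
  last first.
  move=> h /has_contentP hE.
  by rewrite inversions_rcons exprD drawn_above_balls hE balls_above_decr.
rewrite -mulr_sumr -(IHn (decr a c)); first ring.
by apply: succn_inj; rewrite balls_decr.
Qed.

End MacMahon.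

(** * The probability of a color sequence, factored through its content *)

Section WordProb.
Context {R : realType} {k : nat}.
Variables (q : R) (m : int) (r : 'I_k.+1 -> nat).
Implicit Types (h : seq 'I_k.+1) (c nu : 'I_k.+1) (a : 'I_k.+1 -> nat).

Fixpoint word_prob_rev h : R :=
  if h is c :: h' then word_prob_rev h' * draw_prob q m r (rev h') c else 1.

Definition word_prob h : R := word_prob_rev (rev h).

Lemma word_prob_rcons h c :
  word_prob (rcons h c) = word_prob h * draw_prob q m r h c.
Proof. by rewrite /word_prob rev_rcons /= revK. Qed.

(* The total exponent of [q] collected along the nondecreasing word of content
   [a], the only one without inversions. *)
Definition content_exponent a : int :=
  \sum_nu (a nu)%:Z * ((balls_below r nu)%:Z + m * (balls_below a nu)%:Z).

Definition content_weight a : R :=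
  \prod_nu \prod_(i < a nu) (1 - q ^ ((r nu)%:Z + m * i%:Z)).

Definition total_weight n : R :=
  \prod_(i < n) (1 - q ^ ((balls r)%:Z + m * i%:Z)).

(** A new ball [c] adds its own exponent of [q], and raises [balls_below] by one for every greater
    color, which adds [m] for each greater ball already drawn. *)
Lemma content_exponent_rcons h c :
  content_exponent (drawn (rcons h c)) = content_exponent (drawn h)
    + ((balls_below r c)%:Z + m * (drawn_below h c)%:Z)
    + m * (drawn_above h c)%:Z.
Proof.
have -> : (drawn_above h c)%:Z =
    \sum_nu (drawn h nu)%:Z * (c < nu)%N%:Z :> int.
  rewrite drawn_above_balls /balls_above -[LHS]intz sumMz big_mkcond.
  by apply: eq_bigr => nu _; case: ifP; rewrite ?mulr1 ?mulr0 ?intz.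
have -> : (balls_below r c)%:Z + m * (drawn_below h c)%:Z =
    \sum_nu (c == nu)%:Z * ((balls_below r nu)%:Z + m * (drawn_below h nu)%:Z)
    :> int.
  rewrite (bigD1 c) //= eqxx mul1r big1 ?addr0 // => nu.
  by rewrite eq_sym => /negPf ->; rewrite mul0r.
rewrite mulr_sumr -!big_split /=; apply: eq_bigr => nu _.
rewrite -!drawn_below_balls /drawn_below -cats1 count_cat /= !addn0 cats1.
rewrite drawn_rcons !PoszD; case: eqP => [->|_].
  by rewrite ltnn !addr0 !mulr0 addr0; ring.
by rewrite addr0 mul0r addr0; ring.
Qed.

Lemma content_weight_rcons h c :
  content_weight (drawn (rcons h c)) = content_weight (drawn h)
    * (1 - q ^ ((r c)%:Z + m * (drawn h c)%:Z)).
Proof.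
rewrite /content_weight (bigD1 c) //= [in RHS](bigD1 c) //= mulrAC.
rewrite drawn_rcons eqxx addn1 big_ord_recr /=; congr (_ * _).
apply: eq_bigr => nu; rewrite eq_sym => /negPf cnu.
by rewrite drawn_rcons cnu addn0.
Qed.

(** The ball of color [nu] drawn after [i] others of that color contributes [1 - q ^ (r nu + m * i)]
    whenever it is drawn, so these factors depend on the content only. The order enters through the
    powers of [q] alone. *)
Lemma word_prob_content h : q != 0 ->
  word_prob h = q ^ content_exponent (drawn h) * (q ^ (- m)) ^+ inversions h
    * content_weight (drawn h) / total_weight (size h).
Proof.
move=> q0; elim/last_ind: h => [|h c IHh].
  rewrite /word_prob /content_exponent /content_weight /total_weight /=.
  rewrite big1; last by move=> nu _; rewrite mul0r.
  rewrite big1; last by move=> nu _; rewrite big_ord0.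
  by rewrite big_ord0 expr0z !expr0 invr1 !mulr1.
rewrite word_prob_rcons IHh content_weight_rcons content_exponent_rcons.
rewrite size_rcons /total_weight big_ord_recr /= inversions_rcons exprD invfM.
rewrite (expfzDr _ (m * (drawn_above h c)%:Z) q0).
rewrite (expfzDr (content_exponent _) _ q0) /draw_prob.
(* The surplus in the exponent of the content is cancelled by the inversions that [c] creates. *)
have qm : q ^ (m * (drawn_above h c)%:Z) * (q ^ (- m)) ^+ drawn_above h c = 1.
  by rewrite exprnP exprz_exp -expfzDr // mulNr subrr expr0z.
by rewrite -[LHS]mulr1 -[X in _ * X = _]qm; ring.
Qed.

End WordProb.

(** * From conditional probabilities to the law of the history *)

Section Probability.
Context d (T : measurableType d) (R : realType) (P : probability T R).

Lemma measure_color_partition k (A : set T) (f : T -> 'I_k.+1) :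
  measurable A -> (forall nu, measurable [set w | f w = nu]) ->
  P A = (\sum_nu P (A `&` [set w | f w = nu]))%E.
Proof.
move=> mA mf; rewrite -measure_bigsetU_ord.
- congr (P _); rewrite -bigcup_mkord_ord.
  apply/seteqP; split=> [w Aw|w [i _ []//]].
  by exists (f w) => //=; split=> //=; rewrite inord_val.
- by move=> nu; exact: measurableI.
- apply/trivIsetP => i j _ _ /eqP ij; apply/seteqP; split => // w.
  by move=> [[_ /= wi] [_ wj]]; apply: ij; rewrite -wi.
Qed.

Variables (k : nat) (D : nat -> T -> 'I_k.+1).

Lemma historyS i w : history D i.+1 w = rcons (history D i w) (D i w).
Proof. exact: mkseqS. Qed.

Lemma history_rcons_set h c :
  [set w | history D (size h).+1 w = rcons h c] =
  [set w | D (size h) w = c] `&` [set w | history D (size h) w = h].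
Proof.
apply/seteqP; split=> w /=; rewrite historyS.
  by move/rcons_inj => [-> ->].
by case=> -> ->.
Qed.

Lemma measurable_history n h :
  (forall i nu, (i < n)%N -> measurable [set w | D i w = nu]) ->
  (size h <= n)%N -> measurable [set w | history D (size h) w = h].
Proof.
move=> mD; elim/last_ind: h => [_|h c IHh].
  rewrite (_ : [set w | _] = setT) //.
  by apply/seteqP; split.
rewrite size_rcons => hn; rewrite history_rcons_set.
by apply: measurableI; [exact: mD|apply/IHh/ltnW].
Qed.

Lemma measure_history_partition n A :
  (forall i nu, (i < n)%N -> measurable [set w | D i w = nu]) ->
  measurable A ->
  P A = (\sum_(h <- words n) P (A `&` [set w | history D n w = h]))%E.
Proof.
elim: n => [|n IHn] mD mA.
  rewrite big_seq1; congr (P _).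
  by apply/seteqP; split=> w // [].
rewrite (IHn _ mA); last by move=> i nu ?; apply: mD; exact: leqW.
rewrite /= big_allpairs_dep; apply: eq_big_seq => h /size_words hn.
have mh : measurable [set w | history D n w = h].
  rewrite -hn; apply: (@measurable_history n); last by rewrite hn.
  by move=> i nu ?; apply: mD; exact: leqW.
rewrite (measure_color_partition (f := D n)); last 2 first.
- exact: measurableI.
- by move=> nu; exact: mD.
apply: eq_bigr => c _; congr (P _).
by rewrite -hn history_rcons_set setIAC setIA.
Qed.

(** Chain rule: each drawing multiplies the probability by the prescribed conditional one. *)
Lemma history_prob q m r n h :
  qPolya_drawings P D q m r n -> (size h <= n)%N ->
  P [set w | history D (size h) w = h] = (word_prob q m r h)%:E.
Proof.
move=> [mD PD]; elim/last_ind: h => [_|h c IHh].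
  rewrite (_ : [set w | _] = setT) ?probability_setT //.
  by apply/seteqP; split.
rewrite size_rcons => hn; have hn' := ltnW hn.
rewrite word_prob_rcons history_rcons_set.
have mh := measurable_history mD hn'.
have mhc := measurableI _ _ (mD _ c hn) mh.
(* The model prescribes nothing after a null history. There the left side vanishes by monotonicity,
   and the right side because [word_prob] of [h] is 0 by induction. *)
have [h0|h0] := eqVneq (P [set w | history D (size h) w = h]) 0%E.
  have -> : word_prob q m r h = 0 by apply: EFin_inj; rewrite -IHh.
  rewrite mul0r; apply: (subset_measure0 mhc mh) => //; exact: subIsetr.
have := PD h c hn; rewrite lt0e h0 measure_ge0 => /(_ isT).
rewrite /cond_prob => /(canRL (mulfVK _)) => E.
rewrite -[LHS]fineK ?fin_num_measure //; congr EFin.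
rewrite E ?fine_eq0 ?fin_num_measure // mulrC; congr (_ * _).
by rewrite IHh.
Qed.

(** [Q] is arbitrary so that the induction can pass to the predicate [Q (rcons h c)] of the shorter
    history. *)
Lemma measurable_history_event n (Q : pred (seq 'I_k.+1)) :
  (forall i nu, (i < n)%N -> measurable [set w | D i w = nu]) ->
  measurable [set w | Q (history D n w)].
Proof.
elim: n Q => [|n IHn] Q mD.
  have [Q0|Q0] := boolP (Q [::]).
    by rewrite (_ : [set w | _] = setT) //; apply/seteqP; split.
  by rewrite (_ : [set w | _] = set0) //; apply/seteqP; split.
rewrite (_ : [set w | _] = \bigcup_(c in [set: 'I_k.+1])
    ([set w | D n w = c] `&` [set w | Q (rcons (history D n w) c)])).
  apply: fin_bigcup_measurable => // c _; apply: measurableI; first exact: mD.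
  by apply: (IHn (fun h => Q (rcons h c))) => i nu ?; apply: mD; exact: leqW.
apply/seteqP; split=> w /=; rewrite historyS; first by exists (D n w).
by case=> c _ /= [->].
Qed.

Lemma history_event_prob q m r n (Q : pred (seq 'I_k.+1)) :
  qPolya_drawings P D q m r n ->
  P [set w | Q (history D n w)] =
    (\sum_(h <- words n | Q h) word_prob q m r h)%:E.
Proof.
move=> PD; have [mD _] := PD.
rewrite (measure_history_partition mD (measurable_history_event Q mD)).
rewrite -sumEFin [RHS]big_mkcond; apply: eq_big_seq => h /size_words hn.
case: ifPn => Qh.
  rewrite -(history_prob PD) hn //; congr (P _).
  by apply/seteqP; split=> w /= => [[]//|hw]; rewrite hw.
rewrite (_ : _ `&` _ = set0) ?measure0 //.
by apply/seteqP; split=> // w /= [Qw hw]; rewrite hw (negPf Qh) in Qw.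
Qed.

End Probability.

(** * Closed forms with base [q ^ (- m)] *)

Section ClosedForm.
Context {R : realType} {k : nat}.
Variables (q : R) (m : int) (r : 'I_k.+1 -> nat).
Hypotheses (q0 : 0 < q) (m0 : m != 0).
Implicit Types (a : 'I_k.+1 -> nat).

(** Among words of content [a] only the inversion factor varies, and MacMahon's theorem sums it. *)
Lemma sum_word_prob n a : q ^ (- m) != 1 -> balls a = n ->
  \sum_(h <- words n | has_content h a) word_prob q m r h =
  q ^ content_exponent m r a * content_weight q m r a / total_weight q m r n
  * (qfact (q ^ (- m)) n / \prod_nu qfact (q ^ (- m)) (a nu)).
Proof.
move=> p1 an; have p0 : 0 < q ^ (- m) by exact: exprz_gt0.
rewrite -(sum_inversions_words p0 an) mulfK; last first.
  by apply/prodf_neq0 => nu _; exact: qfact_neq0.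
rewrite mulr_sumr big_seq_cond [RHS]big_seq_cond.
apply: eq_bigr => h /andP[/size_words hn /has_contentP ha].
by rewrite word_prob_content ?gt_eqF // ha hn; ring.
Qed.

(** Here [-m * (-s / m - i) = s + m * i]; [s] will be the initial number of balls of one color or of
    the whole urn. *)
Lemma powR_alpha (s i : nat) :
  (q ^ (- m)) `^ (- s%:R / m%:~R - i%:R) = q ^ (s%:Z + m * i%:Z).
Proof.
rewrite -!powR_intmul ?ltW // -powRrM; congr (_ `^ _).
have mR : (m%:~R : R) != 0 by rewrite intr_eq0.
rewrite rmorphN rmorphD rmorphM /=; by field.
Qed.

Lemma qfalling_alpha (s n : nat) :
  qfalling (q ^ (- m)) (- s%:R / m%:~R) n =
  \prod_(i < n) (1 - q ^ (s%:Z + m * i%:Z)) / (1 - q ^ (- m)) ^+ n.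
Proof.
rewrite /qfalling /qnum big_split /= prodr_const card_ord exprVn.
by under eq_bigr do rewrite powR_alpha.
Qed.

Lemma prod_qfalling_alpha a :
  \prod_nu qfalling (q ^ (- m)) (- (r nu)%:R / m%:~R) (a nu) =
  content_weight q m r a / (1 - q ^ (- m)) ^+ balls a.
Proof.
under eq_bigr do rewrite qfalling_alpha.
by rewrite big_split /= prodfV -expr_sum.
Qed.

Lemma Posz_balls_below a nu :
  (balls_below a nu)%:Z = \sum_(i < k.+1 | (i < nu)%N) (a i)%:Z.
Proof. exact: (big_morph Posz PoszD erefl). Qed.

Lemma Posz_balls_above a nu :
  (balls_above a nu)%:Z = \sum_(i < k.+1 | (nu < i)%N) (a i)%:Z.
Proof. exact: (big_morph Posz PoszD erefl). Qed.

(** Both sides sum [a nu * (r i + m * a i)] over the pairs [i < nu], grouped by the greater color on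
    the left and by the smaller one on the right. *)
Lemma content_exponent_above a :
  content_exponent m r a =
  \sum_nu (balls_above a nu)%:Z * ((r nu)%:Z + m * (a nu)%:Z).
Proof.
rewrite /content_exponent.
under eq_bigr => nu _.
  rewrite !Posz_balls_below mulr_sumr -big_split /= mulr_sumr big_mkcond /=.
  over.
rewrite exchange_big /=; apply: eq_bigr => i _.
rewrite Posz_balls_above mulr_suml [RHS]big_mkcond.
by apply: eq_bigr => nu _; case: ifP.
Qed.

End ClosedForm.

(** Turns the falling factorial of the multinomial coefficient into full factorials, with [n - s] as
    the count of the last color. *)
Lemma qfalling_qfact (R : realType) (p : R) n s : (s <= n)%N ->
  qfalling p n%:R s * qfact p (n - s) = qfact p n.
Proof.
elim: s => [|s IHs] sn; first by rewrite /qfalling big_ord0 mul1r subn0.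
rewrite -[RHS]IHs 1?ltnW // /qfalling big_ord_recr /= -natrB 1?ltnW //.
by rewrite -mulrA [qnum _ _ * _]mulrC -(subnSK sn) qfactS.
Qed.

(** * Vectors completed by the entry of the last color *)

Section ExtendLast.
Variables (S : Type) (k : nat) (f : 'I_k -> S) (a : S).

Lemma extend_last_lift j : extend_last f a (lift ord_max j) = f j.
Proof. by rewrite /extend_last liftK. Qed.

Lemma extend_last_max : extend_last f a ord_max = a.
Proof. by rewrite /extend_last unlift_none. Qed.

Lemma extend_lastE (g : 'I_k.+1 -> S) :
  (forall j, f j = g (lift ord_max j)) -> a = g ord_max ->
  extend_last f a = g.
Proof.
move=> fg ag; apply: funext => j.
by rewrite /extend_last; case: unliftP => [i|] ->.
Qed.

End ExtendLast.

Lemma balls_extend_last k (x : 'I_k -> nat) n : (\sum_(j < k) x j <= n)%N ->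
  balls (extend_last x (n - \sum_(j < k) x j)%N) = n.
Proof.
move=> xn; rewrite /balls (bigD1_ord ord_max) //= extend_last_max.
under [X in (_ + X)%N]eq_bigr do rewrite extend_last_lift.
by rewrite subnK.
Qed.

(** Identifies [n - y_j] as the number of balls above color [j]. *)
Lemma balls_above_extend_last k (x : 'I_k -> nat) n (j : 'I_k) :
  (\sum_(j < k) x j <= n)%N ->
  ((\sum_(i < k | (i <= j)%N) x i)
   + balls_above (extend_last x (n - \sum_(j < k) x j)) (lift ord_max j))%N = n.
Proof.
move=> /balls_extend_last xn; rewrite -[RHS]xn /balls.
rewrite (bigID (fun i : 'I_k.+1 => (i <= j)%N)) /=; congr (_ + _)%N; last first.
  by apply: eq_bigl => i; rewrite lift_max ltnNge.
rewrite big_mkcond [RHS]big_mkcond [RHS](bigD1_ord ord_max) //=.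
rewrite leqNgt ltn_ord add0n; apply: eq_bigr => i _.
by rewrite -[bump k i]/(nat_of_ord (lift ord_max i)) lift_max extend_last_lift.
Qed.

(** * The joint law of the color counts *)

Theorem theorem3p1 (R : realType) (d : measure_display)
    (T : measurableType d) (P : probability T R)
    (k n : nat) (q : R) (m : int) (r : 'I_k.+1 -> nat)
    (X : 'I_k -> T -> nat) (x : 'I_k -> nat) :
  (0 < k)%N -> (0 < n)%N ->
  (0 < q < 1 \/ 1 < q) ->
  m != 0 ->
  (forall nu, (1 <= r nu)%N) ->
  urn_well_defined q m r n ->
  qPolya_distributed P X q m r n ->
  (forall j, (x j <= n)%N) ->
  (\sum_(j < k) x j <= n)%N ->
  let p : R := q ^ (- m) in
  let alpha : 'I_k -> R := fun j => - (r (lift ord_max j))%:R / m%:~R in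
  let alphatot : R := - (balls r)%:R / m%:~R in
  let alphas : 'I_k.+1 -> R :=
    extend_last alpha (alphatot - \sum_(j < k) alpha j) in
  let xs : 'I_k.+1 -> nat := extend_last x (n - \sum_(j < k) x j)%N in
  let y : 'I_k -> nat := fun j => (\sum_(i < k | (i <= j)%N) x i)%N in
  let c : R :=
    q `^ (- m%:~R * \sum_(j < k) (n%:R - (y j)%:R) * (alpha j - (x j)%:R)) in
  P [set w | forall j : 'I_k, X j w = x j] =
    (c * (\prod_(j < k.+1) qbinom p (alphas j) (xs j))
       / qbinom p alphatot n)%:E
  /\
  c * (\prod_(j < k.+1) qbinom p (alphas j) (xs j)) / qbinom p alphatot n =
    qmultinom p n%:R x * c
    * ((\prod_(j < k.+1) qfalling p (alphas j) (xs j))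
       / qfalling p alphatot n).
Proof.
move=> _ _ q01 m0 _ _ [D [PD XD]] _ xn p alpha alphatot alphas xs y c.
have q0 : 0 < q by case: q01 => [/andP[]//|]; exact: lt_trans.
have q1 : q != 1 by case: q01 => [/andP[_ /lt_eqF->]//|/gt_eqF->].
have p0 : 0 < p by exact: exprz_gt0.
have p1 : p != 1.
  by rewrite pexprz_eq1 ?ltW // oppr_eq0 negb_or m0.
have mR : (m%:~R : R) != 0 by rewrite intr_eq0.
(* As the [r nu] add up to [balls r], the last parameter has the same form as the others. *)
have alphasE : alphas = fun nu => - (r nu)%:R / m%:~R.
  apply: extend_lastE => //; rewrite /alphatot /balls (bigD1_ord ord_max) //=.
  have -> : \sum_j alpha j = - (\sum_(j < k) r (lift ord_max j))%:R / m%:~R.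
    by rewrite natr_sum -sumrN mulr_suml.
  by rewrite natrD; ring.
have xsn : balls xs = n by exact: balls_extend_last.
(* No color lies above the last one, so [k] terms remain; in them [balls_above] is [n - y j], and
   [r + m * x = -m * (alpha - x)]. *)
have cE : c = q ^ content_exponent m r xs.
  rewrite /c -powR_intmul ?ltW //; congr (_ `^ _).
  rewrite content_exponent_above (bigD1_ord ord_max) //=.
  have -> : balls_above xs ord_max = 0%N.
    by rewrite /balls_above big_pred0 // => i; rewrite ltnNge -ltnS ltn_ord.
  rewrite mul0r add0r rmorph_sum mulr_sumr; apply: eq_bigr => j _ /=.
  rewrite rmorphM rmorphD rmorphM /= /xs extend_last_lift.
  have -> : n%:R - (y j)%:R = (balls_above xs (lift ord_max j))%:R :> R.
    apply/(canLR (addrK _)).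
    by rewrite -natrD addnC; congr _%:R; rewrite balls_above_extend_last.
  rewrite /alpha -!pmulrn; move: _%:R (r _)%:R (x j)%:R => B rj xj.
  by move: (m%:~R) mR => M M0; clear -M0; field.
(* Separating falling factorials from factorials serves both equalities. *)
have qbE : c * (\prod_j qbinom p (alphas j) (xs j)) / qbinom p alphatot n =
    c * (\prod_j qfalling p (alphas j) (xs j) / qfalling p alphatot n)
      * (qfact p n / \prod_j qfact p (xs j)).
  rewrite /qbinom big_split /= prodfV invf_div -!mulrA; congr (_ * (_ * _)).
  by rewrite mulrCA [RHS]mulrCA [X in _ * X = _]mulrC.
have wE : \sum_(h <- words n | has_content h xs) word_prob q m r h =
    q ^ content_exponent m r xs * content_weight q m r xs
      / total_weight q m r n * (qfact p n / \prod_nu qfact p (xs nu)).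
  exact: sum_word_prob.
have fE : \prod_nu qfalling p (alphas nu) (xs nu) =
    content_weight q m r xs / (1 - p) ^+ n.
  by rewrite alphasE prod_qfalling_alpha // xsn.
have tE : qfalling p alphatot n = total_weight q m r n / (1 - p) ^+ n.
  exact: qfalling_alpha.
split.
  (* [X] records the first [k] colors only; the count of the last is what remains of the [n]
     drawings, so the whole content is determined. *)
  rewrite (_ : [set w | _] = [set w | has_content (history D n w) xs]).
    rewrite (history_event_prob (has_content^~ xs) PD) wE qbE cE fE tE.
    (* Numerator and denominator carry the same power of [1 - p], since [balls xs = n]. *)
    have e0 : (1 - p) ^+ n != 0 by rewrite expf_neq0 // subr_eq0 eq_sym.
    by rewrite invf_div !mulrA divfK.
  apply/seteqP; split=> w /= H; last first.
    move=> j; rewrite XD /color_count.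
    have <- : xs (lift ord_max j) = x j by exact: extend_last_lift.
    by move/has_contentP: H => <-.
  apply/has_contentP; symmetry; apply: extend_lastE => [j|].
    by rewrite -H XD.
  rewrite -[n in LHS](size_mkseq (D ^~ w) n) size_drawn /balls.
  rewrite (bigD1_ord ord_max) //=.
  by under [X in (_ - X)%N]eq_bigr do rewrite -H XD; rewrite addnK.
(* The multinomial coefficient lists [k] lower entries; the factorial of the last color completes
   both its numerator and its denominator. *)
rewrite qbE; have -> : qmultinom p n%:R x = qfact p n / \prod_j qfact p (xs j).
  rewrite /qmultinom -(qfalling_qfact p xn) (bigD1_ord ord_max) //=.
  rewrite /xs extend_last_max.
  under [X in _ = _ / (_ * X)]eq_bigr do rewrite extend_last_lift.
  by rewrite -mulf_div mulrA divfK ?qfact_neq0.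
by rewrite [LHS]mulrC; exact: mulrA.
Qed.
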